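(* Assume that the frequencies $\omega_1,\omega_2,\dots$ are independent and identically distributed, non-deterministic, real random variables with cumulative distribution function $F$, and that $F$ is MMC($\xi_N$) for a sequence $\xi_N>0$. For each $N$ consider the system $$\frac{d}{dt}\theta_i=\omega_i+\frac{\gamma_N}{N}\sum_{j=1}^N\sin(\theta_j-\theta_i),\qquad i=1,\dots,N,$$ with coupling strength $\gamma_N>0$. Then $$\limsup_{N\to\infty}\frac{\gamma_N}{\xi_N}<\frac12\ \Longrightarrow\ \lim_{N\to\infty}\mathcal{P}_{\mathsf{sync}}(\gamma_N)=0,$$ and $$\liminf_{N\to\infty}\frac{\gamma_N}{\xi_N}>1\ \Longrightarrow\ \lim_{N\to\infty}\mathcal{P}_{\mathsf{sync}}(\gamma_N)=1.$$
   Context: $\mathcal{P}_{\mathsf{sync}}(\gamma_N)$ is the probability (over the i.i.d. choice of $\omega_1,\dots,\omega_N$ with cdf $F$) that the system supports a stable phase-locked solution, i.e. a solution in which all $\theta_i$ rotate with the common velocity $\bar\omega=\frac1N\sum_i\omega_i$ (equivalently, a fixed point of the system with $\omega_i$ replaced by $\omega_i-\bar\omega$) and which is orbitally (linearly) stable: the Jacobian at the fixed point has a simple zero eigenvalue, with eigenvector $(1,\dots,1)^t$, and $N-1$ strictly negative eigenvalues. Non-deterministic means that there is no $x$ with $\mathbb{P}(\omega_i=x)=1$. Min-max concentration: for i.i.d. $X_i$ with cdf $F$, let $M_N=\max_{1\le i\le N}X_i-\min_{1\le i\le N}X_i$. $F$ (or $X_i$) is MMC($\xi_N$) if $M_N/\xi_N\to1$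 in probability, i.e. $\lim_{N\to\infty}\mathbb{P}(|M_N/\xi_N-1|>\epsilon)=0$ for all $\epsilon>0$. *)

(* Defs.v *)
From HB Require Import structures.
From mathcomp Require Import all_boot all_order all_algebra.
From mathcomp Require Import all_classical all_reals all_analysis.

Set Implicit Arguments.
Unset Strict Implicit.
Unset Printing Implicit Defensive.

Import Order.TTheory GRing.Theory Num.Theory.
Import numFieldNormedType.Exports.

Local Open Scope classical_set_scope.
Local Open Scope ring_scope.

Section Kuramoto.
Context {R : realType} {N : nat}.
Implicit Types (w th : 'rV[R]_N) (J : 'M[R]_N) (K : R) (theta : R -> 'rV[R]_N).

Definition kuramoto_field K w th : 'rV[R]_N :=
  \row_i (w ord0 i + K / N%:R * \sum_(j < N) sin (th ord0 j - th ord0 i)).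

Definition mean w : R := (\sum_(i < N) w ord0 i) / N%:R.

Definition corotating_field K w : 'rV[R]_N -> 'rV[R]_N :=
  kuramoto_field K (w - const_mx (mean w)).

Definition kuramoto_solution K w theta : Prop :=
  forall (t : R) (i : 'I_N),
    is_derive t 1 (fun s => theta s ord0 i)
      (kuramoto_field K w (theta t) ord0 i).

Definition phase_locked w theta : Prop :=
  forall t, theta t = theta 0 + const_mx (t * mean w).

(* Eigenvalues are counted with algebraic multiplicity. Jacobians act on row
   vectors (['D_v f p = v *m 'J f p]), so the eigenvector is on the left. *)
Definition orbitally_stable J : Prop :=
  const_mx 1 *m J = 0 :> 'rV[R]_N /\
  exists mu : seq R,
    [/\ size mu = N.-1, all (fun m => m < 0) mu
      & char_poly J = 'X * \prod_(m <- mu) ('X - m%:P)].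

(* A phase-locked solution is an equilibrium in the frame rotating with velocity
   [mean w]; its position there is [theta 0]. *)
Definition supports_stable_phase_locked K w : Prop :=
  exists theta,
    [/\ kuramoto_solution K w theta, phase_locked w theta
      & orbitally_stable (jacobian (corotating_field K w) (theta 0))].

End Kuramoto.

(* Sequences are indexed from 0: omega_1, ..., omega_N are [X 0, ..., X N.-1]. *)
Section Probability.
Context {d : measure_display} {T : measurableType d} {R : realType}.
Variable P : probability T R.
Implicit Types (X : nat -> {RV P >-> R}) (F : R -> R) (xi : nat -> R).

Definition mutually_independent X : Prop :=
  forall (s : seq nat) (B : nat -> set R),
    uniq s -> (forall i, measurable (B i)) ->
    P (\big[setI/setT]_(i <- s) (X i @^-1` B i)) =
    (\prod_(i <- s) P (X i @^-1` B i))%E.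

Definition iid_with_cdf X F : Prop :=
  mutually_independent X /\ forall i r, cdf (X i) r = (F r)%:E.

Definition non_deterministic (Y : {RV P >-> R}) : Prop :=
  ~ exists x : R, P (Y @^-1` [set x]) = 1%E.

(* Only meaningful for [0 < N]; [X 0] then belongs to the range of the index. *)
Definition spread X (N : nat) (x : T) : R :=
  \big[Num.max/X 0 x]_(i < N) X i x - \big[Num.min/X 0 x]_(i < N) X i x.

Definition MMC X xi : Prop :=
  forall e : R, 0 < e ->
    P [set x | `|spread X N x / xi N - 1| > e] @[N --> \oo] --> 0%E.

Definition P_sync X (N : nat) (K : R) : \bar R :=
  P [set x | supports_stable_phase_locked K (\row_(i < N) X i x)].

End Probability.

(* Main.v *)
(** At an equilibrium of the corotating field each coupling term is at most [K]
in absolute value, so two frequencies differ by at most [2 K]. Conversely, if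
all frequencies differ by less than [K], minimize the [potential], of which the
field is minus the gradient, over the phases contained in an arc of length [pi /
2]. When two phases are exactly [pi / 2] apart, [sin a + cos a >= 1] on [[0, pi
/ 2]] makes the field pull them together, so moving along the field stays in the
arc and the minimizer is an equilibrium inside it; there all cosines are
positive, minus the Jacobian is a weighted Laplacian of the complete graph, and
the equilibrium is stable. Hence spread [< K] forces synchronization and
synchronization forces spread [<= 2 K], and concentration of the spread around
[xi N] gives both limits.

Since a measure is unconstrained on non-measurable sets, the synchronization
event must be shown to be measurable: it says that the frequencies lie in the
image under a continuous map of an open set of stable phases. *)

From mathcomp Require Import complex.
Require Import Defs.
From HB Require Import structures.
From mathcomp Require Import all_boot all_order all_algebra.
From mathcomp Require Import all_classical all_reals all_analysis.
From mathcomp Require Import measurable_realfun.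
From mathcomp Require Import ring lra zify.

Set Implicit Arguments.
Unset Strict Implicit.
Unset Printing Implicit Defensive.

Import Order.TTheory GRing.Theory Num.Theory.
Import numFieldNormedType.Exports.

Local Open Scope classical_set_scope.
Local Open Scope ring_scope.

(** * Spectra of symmetric matrices and weighted Laplacians *)

Lemma char_poly_simmx (F : fieldType) n (Q A : 'M[F]_n) :
  Q \in unitmx -> char_poly (invmx Q *m A *m Q) = char_poly A.
Proof.
move=> Qu; rewrite /char_poly /char_poly_mx !map_mxM.
set Q' := map_mx polyC Q; set V := map_mx polyC (invmx Q).
have VQ : V *m Q' = 1%:M by rewrite -map_mxM mulVmx// map_mx1.
have -> : 'X%:M - V *m map_mx polyC A *m Q' =
    V *m ('X%:M - map_mx polyC A) *m Q'.
  rewrite mulmxBr mulmxBl; congr (_ - _).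
  by rewrite -mulmxA -scalar_mxC mulmxA VQ mul1mx.
by rewrite !det_mulmx mulrC mulrA -det_mulmx (mulmx1C VQ) det1 mul1r.
Qed.

Lemma rank_diag_mx_le (F : fieldType) n (d : 'rV[F]_n) :
  (\rank (diag_mx d) <= #|[pred i | d 0%R i != 0%R]|)%N.
Proof.
pose B i : 'M[F]_n := delta_mx i i.
have /mxrankS/leq_trans-> // : (diag_mx d <= \sum_(i | d 0%R i != 0%R) B i)%MS.
  apply/row_subP => i; rewrite row_diag_mx.
  have [->|di0] := eqVneq (d 0 i) 0; first by rewrite scale0r sub0mx.
  apply: scalemx_sub; apply: (sumsmx_sup i) => //.
  by apply/submxP; exists (delta_mx 0 i); rewrite mul_delta_mx.
rewrite -sum1_card; elim/big_ind2 : _ => [|A m D p hA hD|i _].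
- by rewrite mxrank0.
- by rewrite (leq_trans (mxrank_adds_leqif _ _))// leq_add.
- by rewrite mxrank_delta.
Qed.

(** Spectral theorem: over [R[i]] the matrix is Hermitian, hence diagonalizable with real
    eigenvalues, and the embedding preserves characteristic polynomial and rank. The rank bound
    later controls the multiplicity of the root 0. *)
Lemma symmetric_char_poly (R : rcfType) n (A : 'M[R]_n) : A^T = A ->
  exists2 m : 'I_n -> R, char_poly A = \prod_i ('X - (m i)%:P) &
    (\rank A <= #|[pred i | m i != 0%R]|)%N.
Proof.
move=> symA; pose f := real_complex R; pose B := map_mx f A.
have hermB : B \is hermitianmx _ false Num.conj.
  apply: realsym_hermsym.
    by apply/is_hermitianmxP; rewrite expr0 scale1r map_mx_id// map_trmx symA.
  by apply/mxOverP => i j; rewrite mxE; apply/complex_realP; exists (A i j).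
have /orthomx_spectralP Beq := hermitian_normalmx hermB.
have /mxOverP sp_real := hermitian_spectral_diag_real hermB.
have /choice[m mE] i : exists m, spectral_diag B 0 i = f m.
  exact/complex_realP.
have uP := spectral_unit B.
exists m.
  apply: (@map_poly_inj _ _ f); rewrite map_char_poly -/B Beq.
  rewrite char_poly_simmx// char_poly_trig ?diag_mx_is_trig//.
  rewrite rmorph_prod; apply: eq_bigr => i _.
  by rewrite mxE eqxx mulr1n mE rmorphB/= map_polyX map_polyC.
rewrite -(mxrank_map f) -/B Beq mxrankMfree ?row_free_unit//.
rewrite (eqmxMfull _ _) ?row_full_unit ?unitmx_inv//.
rewrite (leq_trans (rank_diag_mx_le _))//.
apply: subset_leq_card; apply/fintype.subsetP => i.
by rewrite !inE mE; apply: contra_neq => ->.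
Qed.

Lemma coef_prod_neg_roots_gt0 (R : realDomainType) (s : seq R) k :
  all (fun m => m < 0) s -> (k <= size s)%N ->
  0 < (\prod_(m <- s) ('X - m%:P))`_k.
Proof.
elim: s k => [|m s IHs] k /=.
  by rewrite big_nil leqn0 => _ /eqP->; rewrite coef1.
move=> /andP[m_lt0 s_lt0] ks; rewrite big_cons mulrBl coefB coefXM mul_polyC coefZ.
(* Coefficient [k] is the preceding coefficient of the shorter product (0 if [k = 0]) minus [m]
   times its coefficient [k]; in top degree only the former survives. *)
rewrite subr_gt0; move: ks; rewrite leq_eqVlt => /predU1P[->|ks] /=.
  rewrite [X in _ * X]nth_default ?mulr0 ?IHs//.
  by rewrite size_prod_XsubC.
have mp : m * (\prod_(m <- s) ('X - m%:P))`_k < 0 by rewrite nmulr_rlt0// IHs.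
by case: eqP => // /eqP k0; rewrite (lt_trans mp)// IHs// -ltnS prednK ?lt0n// ltnW.
Qed.

Section orbital_stability.
Context {R : realType} {N : nat}.
Implicit Types J : 'M[R]_N.

Lemma orbitally_stable_spectrum J (m : 'I_N -> R) (i0 : 'I_N) :
  const_mx 1 *m J = 0 :> 'rV[R]_N -> char_poly J = \prod_i ('X - (m i)%:P) ->
  m i0 = 0 -> (forall i, i != i0 -> m i < 0) -> orbitally_stable J.
Proof.
move=> J1 charJ mi0 mi; split=> //.
exists [seq m i | i <- enum 'I_N & i != i0]; split.
- rewrite size_map -[in RHS](card_ord N) (cardD1 i0) inE /= cardE size_filter.
  rewrite -size_filter enumT; congr size.
  by apply: eq_filter => i; rewrite !inE andbT.
- by rewrite all_map; apply/allP => i; rewrite mem_filter => /andP[/mi].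
- rewrite charJ (bigD1 i0)//= mi0 subr0 big_map big_filter.
  by rewrite [in RHS]big_enum_cond.
Qed.

Hypothesis N_gt0 : (0 < N)%N.

Lemma eigenvalue0_spectrum J (m : 'I_N -> R) :
  const_mx 1 *m J = 0 :> 'rV[R]_N -> char_poly J = \prod_i ('X - (m i)%:P) ->
  exists i0, m i0 = 0.
Proof.
move=> J1 charJ.
have : eigenvalue J 0.
  apply/eigenvalueP; exists (const_mx 1); first by rewrite J1 scale0r.
  apply/eqP => /rowP/(_ (Ordinal N_gt0)); rewrite !mxE => /eqP.
  by rewrite oner_eq0.
rewrite eigenvalue_root_char charJ /root horner_prod prodf_seq_eq0 => /hasP[i _].
by rewrite hornerXsubC sub0r oppr_eq0 => /eqP; exists i.
Qed.

(* By symmetry all roots are real, and a real-rooted polynomial has only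
   negative roots iff its coefficients are positive. *)
Lemma orbitally_stable_coef J : J^T = J -> const_mx 1 *m J = 0 :> 'rV[R]_N ->
  orbitally_stable J <-> forall k : 'I_N, 0 < (char_poly J)`_k.+1.
Proof.
move=> symJ J1; split=> [[_ [mu [sz mu_lt0 ->]]] k|coef_gt0].
  by rewrite coefXM/= coef_prod_neg_roots_gt0// sz -ltnS prednK.
have [m charJ _] := symmetric_char_poly symJ.
have [i0 mi0] := eigenvalue0_spectrum J1 charJ.
apply: (orbitally_stable_spectrum J1 charJ mi0) => j ji0.
pose q := \prod_(i | i != i0) ('X - (m i)%:P).
have charq : char_poly J = 'X * q by rewrite charJ (bigD1 i0)//= mi0 subr0.
have szq : size q = N.
  have := size_char_poly J; rewrite charq mulrC size_mulX; first by case.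
  by apply: contra_eq_neq charq => ->; rewrite mulr0 -size_poly_eq0 size_char_poly.
rewrite ltNge; apply/negP => mj_ge0.
have : q.[m j] = 0.
  by rewrite /q (bigD1 j)//= hornerM hornerXsubC subrr mul0r.
apply/eqP; rewrite gt_eqF// (@horner_coef_wide _ N) ?szq//.
have qk (k : 'I_N) : 0 < q`_k by have := coef_gt0 k; rewrite charq coefXM.
rewrite (bigD1 (Ordinal N_gt0))//= expr0 mulr1 ltr_pwDl ?qk//.
  exact: (qk (Ordinal N_gt0)).
by rewrite sumr_ge0// => k _; rewrite mulr_ge0 ?exprn_ge0// ltW.
Qed.

End orbital_stability.

(** * Negative semidefiniteness and corank one of minus a weighted Laplacian *)

Section laplacian.
Context {R : realType} {N : nat}.
Variable J : 'M[R]_N.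
Hypotheses (symJ : J^T = J) (J1 : const_mx 1 *m J = 0 :> 'rV[R]_N).

Lemma laplacian_colsum j : \sum_i J i j = 0.
Proof.
have /rowP/(_ j) := J1; rewrite !mxE; apply: etrans.
by apply: eq_bigr => i _; rewrite mxE mul1r.
Qed.

(** Row and column sums vanish, so expanding the square leaves only the cross terms. *)
Lemma laplacian_form (v : 'rV[R]_N) :
  \sum_i \sum_j J i j * (v 0 i - v 0 j) ^+ 2 =
  - (2 * \sum_j (v *m J) 0 j * v 0 j).
Proof.
have Jsym i j : J i j = J j i by rewrite -{1}symJ mxE.
pose S := \sum_i \sum_j v 0 i * J i j * v 0 j.
pose D := \sum_i \sum_j J i j * v 0 i ^+ 2.
have D0 : D = 0.
  rewrite /D big1// => i _; rewrite -mulr_suml.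
  by under eq_bigr do rewrite Jsym; rewrite laplacian_colsum mul0r.
have -> : \sum_j (v *m J) 0 j * v 0 j = S.
  rewrite /S exchange_big; apply: eq_bigr => j _.
  by rewrite mxE mulr_suml.
pose E := \sum_i \sum_j J i j * v 0 j ^+ 2.
have E0 : E = 0.
  rewrite /E exchange_big big1// => j _.
  by rewrite -mulr_suml laplacian_colsum mul0r.
have -> : - (2 * S) = D + E - (S + S) by rewrite D0 E0; ring.
rewrite /D /E /S -!big_split -sumrB; apply: eq_bigr => i _.
rewrite -!big_split -sumrB; apply: eq_bigr => j _ /=.
by ring.
Qed.

Hypothesis J_gt0 : forall i j, i != j -> 0 < J i j.

Lemma laplacian_term_ge0 (v : 'rV[R]_N) i j : 0 <= J i j * (v 0 i - v 0 j) ^+ 2.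
Proof.
have [->|/J_gt0/ltW Jij] := eqVneq i j; first by rewrite subrr expr0n mulr0.
by rewrite mulr_ge0// sqr_ge0.
Qed.

(** On an eigenvector [v] the nonnegative form equals [- 2 a |v|^2]. *)
Lemma laplacian_eigenvalue_le0 (a : R) : eigenvalue J a -> a <= 0.
Proof.
move=> /eigenvalueP[v va v0].
have : 0 <= \sum_i \sum_j J i j * (v 0 i - v 0 j) ^+ 2.
  by do 2![apply: sumr_ge0 => ? _]; exact: laplacian_term_ge0.
rewrite laplacian_form va oppr_ge0 pmulr_rle0//.
have -> : \sum_j (a *: v) 0 j * v 0 j = a * \sum_j v 0 j ^+ 2.
  by rewrite mulr_sumr; apply: eq_bigr => j _; rewrite mxE -mulrA expr2.
rewrite pmulr_lle0// lt_def sumr_ge0 ?andbT => [|j _]; last exact: sqr_ge0.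
apply: contra_neq v0 => /eqP; rewrite psumr_eq0 => [/allP v0|j _]; last exact: sqr_ge0.
apply/rowP => j; rewrite mxE; apply/eqP; rewrite -sqrf_eq0.
by have := v0 j; rewrite mem_index_enum; apply.
Qed.

(** On the kernel the form is 0, so each of its nonnegative terms is, and every pair has positive
    weight. *)
Lemma laplacian_ker (v : 'rV[R]_N) i j : v *m J = 0 -> v 0 i = v 0 j.
Proof.
move=> vJ; have [->//|ij] := eqVneq i j.
have := laplacian_form v; rewrite vJ [X in 2 * X]big1 => [|k _]; last first.
  by rewrite mxE mul0r.
rewrite mulr0 oppr0 => /eqP; rewrite psumr_eq0 => [/allP/(_ i)|k _]; last first.
  by apply: sumr_ge0 => l _; exact: laplacian_term_ge0.
rewrite mem_index_enum => /(_ isT).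
rewrite psumr_eq0 => [/allP/(_ j)|l _]; last exact: laplacian_term_ge0.
rewrite mem_index_enum => /(_ isT).
by rewrite mulf_eq0 gt_eqF ?J_gt0//= sqrf_eq0 subr_eq0 => /eqP.
Qed.

Lemma laplacian_rank : (N.-1 <= \rank J)%N.
Proof.
have [N0|N_gt0] := posnP N; first by apply: (@leq_trans 0) => //; lia.
have ker_le1 : (\rank (kermx J) <= 1)%N.
  apply: leq_trans (rank_leq_row (const_mx 1 : 'rV[R]_N)).
  apply: mxrankS; apply/row_subP => i.
  have kerJ : row i (kermx J) *m J = 0.
    by rewrite -row_mul mulmx_ker row0.
  apply/submxP; exists (row i (kermx J) 0 (Ordinal N_gt0))%:M.
  rewrite mul_scalar_mx; apply/rowP => j.
  by rewrite [RHS]mxE [X in _ * X]mxE mulr1 (laplacian_ker _ (Ordinal N_gt0) kerJ).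
by move: ker_le1; rewrite mxrank_ker; move: (\rank J) => r; lia.
Qed.

Lemma laplacian_orbitally_stable : (0 < N)%N -> orbitally_stable J.
Proof.
move=> N_gt0; have [m charJ rankJ] := symmetric_char_poly symJ.
have [i0 mi0] := eigenvalue0_spectrum N_gt0 J1 charJ.
apply: (orbitally_stable_spectrum J1 charJ mi0) => i ii0.
rewrite lt_neqAle laplacian_eigenvalue_le0 ?andbT; last first.
  rewrite eigenvalue_root_char charJ /root horner_prod (bigD1 i)//=.
  by rewrite hornerXsubC subrr mul0r.
(* A second zero root would leave at most [N - 2] nonzero ones, against a rank of at least
   [N - 1]. *)
apply/eqP => mi; have := leq_trans laplacian_rank rankJ.
apply/negP; rewrite -ltnNge.
have : (#|[pred i | m i != 0%R]| <= #|[set: 'I_N] :\ i :\ i0|)%N.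
  apply: subset_leq_card; apply/fintype.subsetP => k; rewrite !inE andbT.
  by apply: contraNT; rewrite negb_and !negbK => /orP[]/eqP->; rewrite ?mi ?mi0.
move/leq_ltn_trans; apply.
have i0_in : i0 \in [set: 'I_N] :\ i by rewrite !inE eq_sym ii0.
have := cardsD1 i0 ([set: 'I_N] :\ i); have := cardsD1 i [set: 'I_N].
rewrite i0_in cardsT card_ord finset.in_setT /= !add1n.
by move=> /(congr1 predn) /= -> ->.
Qed.

End laplacian.

(** * Linearization of the Kuramoto field *)

Section differentials.
Context {R : realType}.

(** An instance, so that differentials of expressions in the entries are inferred. *)
Global Instance is_diff_coord m n (M : 'M[R]_(m, n)) i j :
  is_diff M (fun A : 'M[R]_(m, n) => A i j : R) (fun A => A i j : R).
Proof.
apply: DiffDef; first exact: differentiable_coord.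
have lin : linear (fun A : 'M[R]_(m, n) => A i j : R).
  by move=> a A B; rewrite !mxE.
pose fM := GRing.isLinear.Build _ _ _ _ _ lin.
pose f : {linear _ -> _} := HB.pack (fun A : 'M[R]_(m, n) => A i j : R) fM.
have -> : (fun A : 'M[R]_(m, n) => A i j : R) = f by [].
exact/diff_lin/coord_continuous.
Qed.

Context {V : normedModType R}.

Lemma is_diff_sum (W : normedModType R) n (f df : 'I_n -> V -> W) (p : V) :
  (forall i, is_diff p (f i) (df i)) ->
  is_diff p (fun q => \sum_i f i q) (fun v => \sum_i df i v).
Proof.
move=> fdf.
have -> : (fun q => \sum_i f i q) = \sum_i f i by apply/funext => q; rewrite fct_sumE.
have -> : (fun q => \sum_i df i q) = \sum_i df i by apply/funext => q; rewrite fct_sumE.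
elim/big_ind2 : _ => [|? ? ? ? ? ?|i _].
- exact: is_diff_cst.
- exact: is_diffD.
- exact: fdf.
Qed.

Lemma is_diff_sin (f df : V -> R) p : is_diff p f df ->
  is_diff p (fun q => sin (f q)) (fun v => cos (f p) * df v).
Proof.
move=> fdf; apply: (@is_diff_comp _ _ _ _ f df sin (fun h => cos (f p) * h)).
apply: DiffDef; first exact/derivable1_diffP/derivable_sin.
rewrite diff1E; last exact/derivable1_diffP/derivable_sin.
by apply/funext => h; rewrite derive1E derive_val mulrC.
Qed.

Lemma is_diff_cos (f df : V -> R) p : is_diff p f df ->
  is_diff p (fun q => cos (f q)) (fun v => - sin (f p) * df v).
Proof.
move=> fdf; apply: (@is_diff_comp _ _ _ _ f df cos (fun h => - sin (f p) * h)).
have dcos : differentiable cos (f p) by apply/derivable1_diffP; exact: ex_derive.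
apply: DiffDef => //; rewrite diff1E//.
by apply/funext => h; rewrite derive1E derive_val mulrC.
Qed.

Lemma is_diff_row n (f df : 'I_n -> V -> R) p :
  (forall i, is_diff p (f i) (df i)) ->
  is_diff p (fun q => \row_i f i q) (fun v => \row_i df i v).
Proof.
have rowE (g : 'I_n -> V -> R) :
    (fun q => \row_i g i q) = (fun q => \sum_i g i q *: delta_mx ord0 i).
  by apply/funext => q; rewrite [LHS]row_sum_delta; under eq_bigr do rewrite mxE.
move=> fdf; rewrite !rowE; apply: is_diff_sum => i.
exact: (@is_diff_comp _ _ _ _ (f i) (df i) (fun x => x *: _) (fun x => x *: _)).
Qed.

End differentials.

Section kuramoto_jacobian.
Context {R : realType} {N : nat}.
Implicit Types (w p : 'rV[R]_N) (K : R).

(** Minus the Laplacian with weights [K / N * cos (p i - p j)]: on the diagonal the term [k = j] of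
    the sum cancels the leading cosine. *)
Definition kuramoto_jacobian K p : 'M[R]_N :=
  \matrix_(i, j) (K / N%:R * (cos (p ord0 i - p ord0 j) -
    (i == j)%:R * \sum_k cos (p ord0 k - p ord0 j))).

Lemma is_diff_kuramoto_field K w p :
  is_diff p (kuramoto_field K w) (fun v => \row_i (K / N%:R *
    \sum_k cos (p ord0 k - p ord0 i) * (v ord0 k - v ord0 i))).
Proof.
apply: is_diff_row => i.
have dS : is_diff p (fun q : 'rV[R]_N => \sum_k sin (q ord0 k - q ord0 i))
    (fun v => \sum_k cos (p ord0 k - p ord0 i) * (v ord0 k - v ord0 i)).
  by apply: is_diff_sum => k; apply: is_diff_sin; exact: is_diffB.
have := is_diffD (is_diff_cst (w ord0 i) p) (is_diffZ (K / N%:R) dS).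
by move/is_diff_eq; apply; rewrite add0r.
Qed.

Lemma jacobian_kuramoto_field K w p :
  jacobian (kuramoto_field K w) p = kuramoto_jacobian K p.
Proof.
have dK := is_diff_kuramoto_field K w p.
apply/matrixP => i j; rewrite /jacobian !mxE diff_val mxE; congr (_ * _).
under eq_bigr do rewrite !mxE eqxx /= mulrBr.
rewrite sumrB (bigD1 i)//= eqxx mulr1 big1 ?addr0; last first.
  by move=> k /negbTE ->; rewrite mulr0.
by rewrite -mulr_suml mulrC eq_sym.
Qed.

Lemma kuramoto_jacobian_sym K p : (kuramoto_jacobian K p)^T = kuramoto_jacobian K p.
Proof.
apply/matrixP => i j; rewrite !mxE -cosN opprB eq_sym.
by have [->|_] := eqVneq i j; rewrite ?mul0r.
Qed.

Lemma kuramoto_jacobian_ones K p :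
  const_mx 1 *m kuramoto_jacobian K p = 0 :> 'rV[R]_N.
Proof.
apply/rowP => j; rewrite !mxE.
under eq_bigr do rewrite !mxE mul1r.
rewrite -mulr_sumr sumrB -mulr_suml (bigD1 j (F := fun i => (i == j)%:R))//=.
rewrite eqxx [X in (_ + X) * _]big1 => [|i /negbTE->//].
by rewrite addr0 mul1r subrr mulr0.
Qed.

End kuramoto_jacobian.

(** * Equilibria *)

Section equilibria.
Context {R : realType} {N : nat}.
Implicit Types (w p : 'rV[R]_N) (K : R).

Lemma corotating_fieldE K w p :
  corotating_field K w p = kuramoto_field K w p - const_mx (mean w).
Proof. by apply/rowP => i; rewrite !mxE addrAC. Qed.

Lemma kuramoto_field_shift K w p (c : R) :
  kuramoto_field K w (p + const_mx c) = kuramoto_field K w p.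
Proof.
apply/rowP => i; rewrite !mxE; congr (_ + _ * _).
by apply: eq_bigr => j _; rewrite !mxE; congr sin; ring.
Qed.

Lemma is_derive_affine (a m t : R) : is_derive t 1 (fun s : R => a + s * m) m.
Proof.
have dm : is_derive t 1 (fun s : R => s * m) m.
  have -> : (fun s : R => s * m) = m \*: id by apply/funext => s; rewrite /= mulrC.
  by apply: is_derive_eq (is_deriveZ _ _) _; rewrite /GRing.scale/= mulr1.
by have := is_deriveD (is_derive_cst a t 1) dm; rewrite add0r.
Qed.

(** A phase-locked orbit is a rigid rotation, and the field is invariant under a common shift of the
    phases. As the Jacobian is independent of the frequencies, stability becomes a condition on [p]
    alone. *)
Lemma supports_equilibrium K w : supports_stable_phase_locked K w <->
  exists2 p, orbitally_stable (kuramoto_jacobian K p) &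
    corotating_field K w p = 0.
Proof.
split=> [[theta [sol locked]]|[p stable_p]].
  rewrite jacobian_kuramoto_field => stable; exists (theta 0) => //.
  apply/eqP; rewrite corotating_fieldE subr_eq0; apply/eqP/rowP => i.
  rewrite [RHS]mxE.
  (* Two values of the derivative at time 0 are compared: the field and the slope [mean w] of the
     locked orbit. *)
  have := sol 0 i; have -> : (fun s => theta s ord0 i) =
      (fun s => theta 0 ord0 i + s * mean w).
    by apply/funext => s; rewrite locked !mxE.
  move=> dtheta; have := @derive_val _ _ _ _ _ _ _ dtheta => <-.
  by have := @derive_val _ _ _ _ _ _ _ (is_derive_affine (theta 0 ord0 i) (mean w) 0).
rewrite corotating_fieldE => /subr0_eq eq_p.
exists (fun t => p + const_mx (t * mean w)); split.
- move=> t i; rewrite kuramoto_field_shift eq_p mxE.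
  have -> : (fun s : R => (p + const_mx (s * mean w)) ord0 i) =
      (fun s => p ord0 i + s * mean w) by apply/funext => s; rewrite !mxE.
  exact: is_derive_affine.
- by move=> t; rewrite mul0r -addrA; congr (_ + _); apply/rowP => i; rewrite !mxE add0r.
- rewrite jacobian_kuramoto_field; have -> // : p + const_mx (0 * mean w) = p.
  by apply/rowP => i; rewrite !mxE mul0r addr0.
Qed.

Lemma equilibrium_spread K w p i j : 0 <= K -> corotating_field K w p = 0 ->
  w ord0 i - w ord0 j <= 2 * K.
Proof.
move=> K0; have N_gt0 : (0 < N)%N := leq_ltn_trans (leq0n i) (ltn_ord i).
rewrite corotating_fieldE => /subr0_eq/rowP fE.
have := fE i; have := fE j; rewrite !mxE.
set Sj := \sum_(_ < N) _; set Si := \sum_(_ < N) _.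
have bound k : `|K / N%:R * \sum_l sin (p ord0 l - p ord0 k)| <= K.
  rewrite normrM ger0_norm ?divr_ge0// -mulrA ler_piMr// mulrC ler_pdivrMr ?ltr0n// mul1r.
  apply: le_trans (ler_norm_sum _ _ _) _.
  apply: (@le_trans _ _ (\sum_(l < N) 1)); last by rewrite sumr_const card_ord.
  by apply: ler_sum => l _; rewrite ler_norml sin_geN1 sin_le1.
have := bound i; have := bound j; rewrite -/Si -/Sj.
by rewrite !ler_norml; lra.
Qed.

End equilibria.

(** Both values lie in [0, 1], so they dominate their squares, which add up to 1. *)
Lemma sin_add_cos_ge1 (R : realType) (a : R) : 0 <= a <= pi / 2 -> 1 <= sin a + cos a.
Proof.
move=> /andP[a0 api2].
have pi_gt0 := pi_gt0 R.
have s0 : 0 <= sin a by apply: sin_ge0_pi; rewrite a0/=; lra.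
have c0 : 0 <= cos a by apply: cos_ge0_pihalf; rewrite api2 andbT; lra.
by have := cos2Dsin2 a; have := cos_le1 a; have := sin_le1 a; nra.
Qed.

Lemma derive_lt0_decreasing (R : realType) (V : normedModType R) (f : V -> R) (p v : V) :
  derivable f p v -> 'D_v f p < 0 ->
  \forall h \near (0:R)^'+, f (h *: v + p) < f p.
Proof.
move=> df D0; have /cvgr_lt/(_ 0 D0) := df.
move=> nearD; have : \forall h \near (0:R)^'+, h^-1 *: (f (h *: v + p) - f p) < 0.
  move: nearD; rewrite !near_withinE; apply: filterS => h hD h0.
  by apply: hD; rewrite gt_eqF.
apply: filterS2 (nbhs_right_gt 0) => h h0.
by rewrite /GRing.scale/= pmulr_rlt0 ?invr_gt0// subr_lt0.
Qed.

(** * An equilibrium by constrained minimization *)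

Section existence.
Context {R : realType} {N : nat}.
Implicit Types (w p q v : 'rV[R]_N) (K : R).

(** The factor 1/2 offsets the double count of each pair, making the field exactly minus the
    gradient. *)
Definition potential K w p : R :=
  - (\sum_i w ord0 i * p ord0 i +
     K / N%:R / 2 * \sum_i \sum_j cos (p ord0 j - p ord0 i)).

Lemma potential_shift K w p c : \sum_i w ord0 i = 0 ->
  potential K w (p + const_mx c) = potential K w p.
Proof.
move=> w0; congr (- (_ + _ * _)).
  under eq_bigr do rewrite !mxE mulrDr.
  by rewrite big_split/= -mulr_suml w0 mul0r addr0.
apply: eq_bigr => i _; apply: eq_bigr => j _; rewrite !mxE; congr cos; ring.
Qed.

Lemma is_diff_potential K w p : is_diff p (potential K w)
  (fun v => - \sum_i kuramoto_field K w p ord0 i * v ord0 i).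
Proof.
pose dcos v := \sum_i \sum_j
  - sin (p ord0 j - p ord0 i) * (v ord0 j - v ord0 i).
have dC : is_diff p (fun q : 'rV[R]_N => \sum_i \sum_j cos (q ord0 j - q ord0 i)) dcos.
  apply: is_diff_sum => i; apply: is_diff_sum => j; apply: is_diff_cos.
have dW : is_diff p (fun q : 'rV[R]_N => \sum_i w ord0 i * q ord0 i)
    (fun v => \sum_i w ord0 i * v ord0 i).
  by apply: is_diff_sum => i; exact: is_diffZ.
have := is_diffN (is_diffD dW (is_diffZ (K / N%:R / 2) dC)).
move/is_diff_eq; apply; apply/funext => v; congr (- _).
transitivity (\sum_i w ord0 i * v ord0 i + K / N%:R / 2 * dcos v) => //.
(* The sine is odd, so swapping the indices turns the [v ord0 j] half into a copy of the [v ord0 i]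
   half. *)
have -> : dcos v = 2 * \sum_i (\sum_j sin (p ord0 j - p ord0 i)) * v ord0 i.
  pose S := \sum_i \sum_j sin (p ord0 j - p ord0 i) * v ord0 i.
  have S' : \sum_i \sum_j sin (p ord0 j - p ord0 i) * v ord0 j = - S.
    rewrite exchange_big /S -sumrN; apply: eq_bigr => i _.
    rewrite -sumrN; apply: eq_bigr => j _.
    by rewrite -mulNr -sinN opprB.
  have -> : \sum_i (\sum_j sin (p ord0 j - p ord0 i)) * v ord0 i = S.
    by apply: eq_bigr => i _; rewrite mulr_suml.
  have -> : 2 * S = S - (- S) by ring.
  rewrite -S' /S -sumrB; apply: eq_bigr => i _.
  by rewrite -sumrB; apply: eq_bigr => j _; ring.
rewrite mulrA divfK ?pnatr_eq0// mulr_sumr -big_split.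
by apply: eq_bigr => i _ /=; rewrite mxE; ring.
Qed.

Variables (K : R) (w : 'rV[R]_N).
Hypotheses (N_gt0 : (0 < N)%N) (w0 : \sum_i w ord0 i = 0).

(** Phases are real lifts, not angles modulo [2 pi]. The set is closed but, being invariant under
    common shifts, unbounded. *)
Definition quarter_arc : set 'rV[R]_N :=
  [set p | forall i j, p ord0 i - p ord0 j <= pi / 2].

Lemma potential_min : exists2 p, quarter_arc p &
  forall q, quarter_arc q -> potential K w p <= potential K w q.
Proof.
(* Intersecting with a box gives a compact set; by shift invariance of the potential nothing is
   lost. *)
pose A := [set p : 'rV[R]_N | forall i,
  `[- (pi / 2 : R), pi / 2]%classic (p ord0 i)] `&` quarter_arc.
have A0 : A 0.
  by split=> [i|i j]; rewrite /= mxE ?in_itv/= ?mxE; have := pi_gt0 R; lra.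
have cA : compact A.
  apply: compact_closedI.
    apply: (@rV_compact _ _ (fun=> `[- (pi / 2), pi / 2]%classic)) => i.
    exact: segment_compact.
  have -> : quarter_arc = \bigcap_i \bigcap_j
      ((fun p : 'rV[R]_N => p ord0 i - p ord0 j) @^-1` [set x | x <= pi / 2]).
    by apply/seteqP; split=> [p pA i _ j _|p pA i j]; [exact: pA|exact: pA].
  apply: closed_bigI => i _; apply: closed_bigI => j _.
  apply: closed_comp (@closed_le _ _) => p _.
  by apply: continuousB; exact: coord_continuous.
have Ucont : {within A, continuous potential K w}.
  apply: continuous_subspaceT => p; apply: differentiable_continuous.
  by have dU := is_diff_potential K w p; exact: ex_diff.
have [p] := compact_EVT_min (ex_intro _ 0 A0) cA Ucont.
rewrite inE => -[_ pA] pmin; exists p => // q qA.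
pose i0 := Ordinal N_gt0.
(* Once its first phase is moved to 0, [q] lies in the box, all phases being within [pi / 2] of the
   first. *)
rewrite -(potential_shift K q (- q ord0 i0) w0); apply: pmin; rewrite inE.
split=> [i|i j]; rewrite /= !mxE; last by have := qA i j; lra.
by rewrite in_itv/=; have := qA i i0; have := qA i0 i; lra.
Qed.

Hypothesis wK : forall i j, w ord0 i - w ord0 j < K.

(** Phase [i] leads [j] by the full arc. With [a = p k - p j] in [0, pi / 2], the sines acting on
    [i] and [j] differ by [- cos a - sin a <= -1]; over [N] terms the coupling difference is at most
    [- K], which outweighs the frequency difference. *)
Lemma kuramoto_field_inward p i j : quarter_arc p ->
  p ord0 i - p ord0 j = pi / 2 ->
  kuramoto_field K w p ord0 i < kuramoto_field K w p ord0 j.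
Proof.
move=> pA pij; rewrite !mxE -subr_lt0.
set Si := \sum_(_ < N) _; set Sj := \sum_(_ < N) _.
have K0 : 0 < K by rewrite (le_lt_trans _ (wK i i))// subrr.
have SN : Si - Sj <= - N%:R.
  rewrite -sumrB -[N in N%:R]card_ord -sumr_const -sumrN; apply: ler_sum => k _.
  have -> : p ord0 k - p ord0 i = (p ord0 k - p ord0 j) - pi / 2 by rewrite -pij; ring.
  rewrite sinBpihalf.
  have := @sin_add_cos_ge1 _ (p ord0 k - p ord0 j).
  have := pA k j; have := pA i k; lra.
have : K / N%:R * (Si - Sj) <= K / N%:R * - N%:R by rewrite ler_wpM2l// divr_ge0// ltW.
rewrite mulrN divfK ?pnatr_eq0 -?lt0n//.
by have := wK i j; lra.
Qed.

Lemma quarter_arc_equilibrium : exists2 p,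
  kuramoto_field K w p = 0 & forall i j, p ord0 i - p ord0 j < pi / 2.
Proof.
have [p pA pmin] := potential_min; pose v := kuramoto_field K w p.
have v0 : v = 0.
  apply: contrapT => /eqP v_neq0.
  have dU := is_diff_potential K w p.
  (* The derivative is minus the squared Euclidean norm of [v]. *)
  have DU : 'D_v (potential K w) p < 0.
    rewrite deriveE; last exact: ex_diff.
    rewrite diff_val oppr_lt0 lt_def sumr_ge0 ?andbT => [|i _]; last exact: sqr_ge0.
    apply: contra_neq v_neq0 => /eqP; rewrite psumr_eq0 => [/allP v0|i _]; last first.
      exact: sqr_ge0.
    apply/rowP => j; rewrite [RHS]mxE; apply/eqP; rewrite -sqrf_eq0 expr2.
    by have := v0 j; rewrite mem_index_enum; apply.
  have dUv : derivable (potential K w) p v by apply: diff_derivable; exact: ex_diff.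
  have lineE h i : (h *: v + p) ord0 i = h * v ord0 i + p ord0 i.
    by rewrite [LHS]mxE [X in X + _]mxE.
  (* Pairs exactly [pi / 2] apart are drawn together by the inward field; all others keep their
     strict bound by continuity. *)
  have stay : \forall h \near (0:R)^'+, quarter_arc (h *: v + p).
    apply: filter_forall => i; apply: filter_forall => j.
    have := pA i j; rewrite le_eqVlt => /predU1P[pij|pij].
      have /ltW vij := kuramoto_field_inward pA pij.
      near=> h; rewrite !lineE.
      have : h * (v ord0 i - v ord0 j) <= 0 by rewrite mulr_ge0_le0// subr_le0.
      lra.
    have dcont : (fun h : R => (h *: v + p) ord0 i - (h *: v + p) ord0 j) @ (0:R)^'+ -->
        p ord0 i - p ord0 j.
      have -> : (fun h : R => (h *: v + p) ord0 i - (h *: v + p) ord0 j) =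
          (fun h => h * (v ord0 i - v ord0 j) + (p ord0 i - p ord0 j)).
        by apply/funext => h; rewrite !lineE; ring.
      rewrite -[X in _ --> X]add0r -[X in _ --> X + _](mul0r (v ord0 i - v ord0 j)).
      apply: cvg_at_right_filter; apply: cvgD; last exact: cvg_cst.
      by apply: cvgM; [exact: cvg_id|exact: cvg_cst].
    by apply: filterS (cvgr_lt _ dcont _ pij) => h /ltW.
  have [h [Uh /pmin]] := filter_ex (filterI (derive_lt0_decreasing dUv DU) stay).
  by rewrite leNgt Uh.
(* A pair exactly [pi / 2] apart would have distinct field values, but the field vanishes. *)
exists p => // i j; rewrite lt_neqAle pA andbT; apply/eqP => /(kuramoto_field_inward pA).
by rewrite -/v v0 !mxE ltxx.
Unshelve. all: by end_near.
Qed.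

End existence.

Lemma supports_of_spread_lt (R : realType) (N : nat) (K : R) (w : 'rV[R]_N) :
  (0 < N)%N -> (forall i j, w ord0 i - w ord0 j < K) ->
  supports_stable_phase_locked K w.
Proof.
move=> N_gt0 wK; pose u := w - const_mx (mean w).
have u0 : \sum_i u ord0 i = 0.
  under eq_bigr do rewrite !mxE.
  rewrite sumrB sumr_const card_ord -[mean w *+ _]mulr_natr divfK ?subrr//.
  by rewrite pnatr_eq0 -lt0n.
have uK i j : u ord0 i - u ord0 j < K.
  by have := wK i j; rewrite !mxE opprB addrA subrK.
have [p p_eq p_arc] := quarter_arc_equilibrium N_gt0 u0 uK.
have K_gt0 : 0 < K by have := uK (Ordinal N_gt0) (Ordinal N_gt0); rewrite subrr.
apply/supports_equilibrium; exists p => //.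
apply: laplacian_orbitally_stable => //.
- exact: kuramoto_jacobian_sym.
- exact: kuramoto_jacobian_ones.
(* Off-diagonal entries are positive multiples of cosines of angles strictly between [- pi / 2] and
   [pi / 2]. *)
- move=> i j /negbTE ij; rewrite mxE ij mul0r subr0.
  rewrite mulr_gt0 ?divr_gt0 ?ltr0n// cos_gt0_pihalf// p_arc andbT.
  by rewrite -opprB ltrN2 p_arc.
Qed.

(** * Measurability of the synchronization event *)

Section measurable_exists.
Context {R : realType} {N : nat}.
Implicit Types (p : 'rV[R]_N) (c : 'rV[rat]_N * 'rV[rat]_N).

Definition rat_box c : set 'rV[R]_N :=
  [set p | forall i, `[ratr (c.1 ord0 i), ratr (c.2 ord0 i)]%classic (p ord0 i)].

(** The lower corner is asked to lie in the box so that the statement also yields a rational point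
    of [A]. *)
Lemma nbhs_rat_box p (A : set 'rV[R]_N) : nbhs p A ->
  exists c, [/\ rat_box c `<=` A, rat_box c (map_mx ratr c.1) & nbhs p (rat_box c)].
Proof.
move=> /nbhs_ballP[e /= e0 peA].
have /choice[a aP] i : exists r : rat, p ord0 i - e < ratr r < p ord0 i.
  have /rat_in_itvoo[r] : p ord0 i - e < p ord0 i by rewrite ltrBlDr ltrDl.
  by rewrite in_itv/= => ?; exists r.
have /choice[b bP] i : exists r : rat, p ord0 i < ratr r < p ord0 i + e.
  have /rat_in_itvoo[r] : p ord0 i < p ord0 i + e by rewrite ltrDl.
  by rewrite in_itv/= => ?; exists r.
exists (\row_i a i, \row_i b i); split.
- move=> q qP; apply: peA; split=> // i j; rewrite ord1.
  have := qP j; rewrite /= !mxE in_itv/= => /andP[aq qb].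
  have /andP[? ?] := aP j; have /andP[? ?] := bP j.
  by rewrite /ball/= ltr_norml; apply/andP; split; lra.
- move=> i; rewrite /= !mxE in_itv/= lexx/=.
  by have /andP[_ ap] := aP i; have /andP[pb _] := bP i; exact/ltW/(lt_trans ap).
- suff : nbhs p [set q : 'rV[R]_N |
      forall i, `[ratr (a i), ratr (b i)]%classic (q ord0 i)].
    by apply: filterS => q qP i; rewrite /= !mxE; exact: qP.
  apply: (@filter_forall _ _ (fun i (q : 'rV[R]_N) =>
    `[ratr (a i), ratr (b i)]%classic (q ord0 i)) (nbhs p)) => i.
  have /andP[_ ap] := aP i; have /andP[pb _] := bP i.
  have ci : (fun q : 'rV[R]_N => q ord0 i) @ p --> p ord0 i by exact: coord_continuous.
  apply: filterS2 (cvgr_gt _ ci _ ap) (cvgr_lt _ ci _ pb) => q aq qb.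
  by rewrite /= in_itv/= !ltW.
Qed.

Lemma compact_rat_box c : compact (rat_box c).
Proof.
apply: (@rV_compact _ _ 
  (fun i => `[ratr (c.1 ord0 i) : R, ratr (c.2 ord0 i)]%classic)).
by move=> i; exact: segment_compact.
Qed.

(* The open set is a countable union of compact rational boxes; on each box, by
   compactness, [h] vanishes somewhere iff its infimum over the rational points
   of the box is 0. *)
Lemma measurable_exists_zero d (T : measurableType d) (O : set 'rV[R]_N)
    (h : 'rV[R]_N -> T -> R) :
  open O -> (forall x, continuous (h ^~ x)) ->
  (forall p, measurable_fun setT (h p)) -> (forall p x, 0 <= h p x) ->
  measurable [set x | exists2 p, O p & h p x = 0].
Proof.
move=> oO ch mh h0.
pose G c n q := [set x | [/\ rat_box c `<=` O, rat_box c (map_mx ratr q) &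
  h (map_mx ratr q) x < n.+1%:R^-1]].
have -> : [set x | exists2 p, O p & h p x = 0] =
    \bigcup_c \bigcap_n \bigcup_q G c n q.
  apply/seteqP; split=> [x [p Op hp]|x [c _ Gx]].
    have /nbhs_rat_box[c [cO _ pc]] : nbhs p O by exact: open_nbhs_nbhs.
    exists c => // n _.
    have hn : \forall y \near p, h y x < n.+1%:R^-1.
      by apply: (cvgr_lt _ (ch x p)); rewrite hp invr_gt0.
    have [c' [c'A /c'A[cq hq] _]] := nbhs_rat_box (filterI pc hn).
    by exists c'.1.
  (* The instance [n = 0] shows that the box is nonempty and contained in [O]. *)
  have [q0 _ [cO c0 _]] := Gx 0%N I.
  have [|p] := compact_EVT_min (ex_intro _ _ c0) (@compact_rat_box c) (f := h ^~ x).
    exact/continuous_subspaceT/ch.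
  rewrite inE => cp pmin; exists p; first exact: cO.
  (* A positive minimum would exceed some [1 / (n + 1)], yet [h] is below that at a rational point
     of the box. *)
  apply/eqP; rewrite eq_le h0 andbT leNgt; apply/negP => hp.
  have [n _ /(_ _ (leqnn n))/= hn] := near_infty_natSinv_lt (PosNum hp).
  have [q _ [_ cq]] := Gx n I; apply/negP; rewrite -leNgt ltW//.
  by apply: lt_le_trans hn _; apply: pmin; rewrite inE.
apply: countable_bigcupT_measurable => [|c]; first exact: countableP.
apply: bigcapT_measurable => n.
apply: countable_bigcupT_measurable => [|q]; first exact: countableP.
(* Only the last condition in [G] involves [x], so [G] is empty or a sublevel set. *)
have [[cO cq]|ncO] := pselect (rat_box c `<=` O /\ rat_box c (map_mx ratr q)); last first.
  rewrite (_ : G _ _ _ = set0)//; apply/seteqP; split=> // x [? ? _].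
  by case: ncO.
rewrite (_ : G _ _ _ = h (map_mx ratr q) @^-1` `]-oo, n.+1%:R^-1[%classic).
  by rewrite -[X in measurable X]setTI; apply: mh => //; exact: measurable_itv.
by apply/seteqP; split=> x /=; rewrite in_itv/= => //; case.
Qed.

End measurable_exists.

(** * Continuity of the coefficients of the characteristic polynomial *)

Section char_poly_continuous.
Context {R : realType} {V : topologicalType}.

(** Stable under sums and products, hence under the Leibniz expansion of a determinant. *)
Definition coef_continuous (P : V -> {poly R}) :=
  forall k, continuous (fun x => (P x)`_k).

Lemma coef_continuous_cst (P : {poly R}) : coef_continuous (fun=> P).
Proof. by move=> k x; exact: cvg_cst. Qed.

Lemma continuous_sumr I (r : seq I) (f : I -> V -> R) :
  (forall i, continuous (f i)) -> continuous (fun x => \sum_(i <- r) f i x).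
Proof.
move=> cf x; elim: r => [|i r IHr].
  by under eq_fun do rewrite big_nil; exact: cvg_cst.
under eq_fun do rewrite big_cons.
by apply: cvgD => //; exact: cf.
Qed.

Lemma coef_continuous_sum I (r : seq I) (P : I -> V -> {poly R}) :
  (forall i, coef_continuous (P i)) ->
  coef_continuous (fun x => \sum_(i <- r) P i x).
Proof.
move=> cP k; under eq_fun do rewrite coef_sum.
by apply: continuous_sumr => i; exact: cP.
Qed.

Lemma coef_continuousM (P Q : V -> {poly R}) :
  coef_continuous P -> coef_continuous Q ->
  coef_continuous (fun x => P x * Q x).
Proof.
move=> cP cQ k; under eq_fun do rewrite coefM.
apply: continuous_sumr => i x.
by apply: cvgM; [exact: cP|exact: cQ].
Qed.

Lemma coef_continuous_prod I (r : seq I) (P : I -> V -> {poly R}) :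
  (forall i, coef_continuous (P i)) ->
  coef_continuous (fun x => \prod_(i <- r) P i x).
Proof.
move=> cP; elim: r => [|i r IHr].
  by under eq_fun do rewrite big_nil; exact: coef_continuous_cst.
by under eq_fun do rewrite big_cons; exact: coef_continuousM.
Qed.

Lemma coef_continuous_char_poly n (A : V -> 'M[R]_n) :
  (forall i j, continuous (fun x => A x i j)) ->
  coef_continuous (fun x => char_poly (A x)).
Proof.
move=> cA; apply: coef_continuous_sum => s.
apply: coef_continuousM; first exact: coef_continuous_cst.
apply: coef_continuous_prod => i k.
under eq_fun do rewrite !mxE coefB coefC.
move=> x; apply: cvgB; first exact: cvg_cst.
by case: eqP => _; [exact: cA|exact: cvg_cst].
Qed.

End char_poly_continuous.

Lemma continuous_kuramoto_jacobian (R : realType) N (K : R) (i j : 'I_N) :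
  continuous (fun p : 'rV[R]_N => kuramoto_jacobian K p i j).
Proof.
move=> p.
have dcos (a b : 'I_N) : is_diff p (fun q : 'rV[R]_N => cos (q ord0 a - q ord0 b))
    (fun v => - sin (p ord0 a - p ord0 b) * (v ord0 a - v ord0 b)).
  by apply: is_diff_cos.
have dJ := is_diffZ (K / N%:R) (is_diffB (dcos i j)
  (is_diffZ (i == j)%:R (is_diff_sum (fun l => dcos l j)))).
have -> : (fun p : 'rV[R]_N => kuramoto_jacobian K p i j) = K / N%:R *:
    ((fun q : 'rV[R]_N => cos (q ord0 i - q ord0 j)) - ((i == j)%:R : R) *:
    (fun q : 'rV[R]_N => \sum_l cos (q ord0 l - q ord0 j))).
  by apply/funext => q; rewrite mxE.
exact: differentiable_continuous (@ex_diff _ _ _ _ _ _ _ dJ).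
Qed.

Section measurability.
Context {d : measure_display} {T : measurableType d} {R : realType}.
Variable P : probability T R.
Implicit Types (X : nat -> {RV P >-> R}).

(** The event is the existence of a zero of [h] in [O]: the set [O] of stable phases does not depend
    on [x], and [h], the l1 norm of the corotating field, vanishes exactly at equilibria. *)
Lemma measurable_supports X N K : (0 < N)%N ->
  measurable [set x | supports_stable_phase_locked K (\row_(i < N) X i x)].
Proof.
move=> N_gt0; pose O := [set p : 'rV[R]_N | orbitally_stable (kuramoto_jacobian K p)].
pose row_X x : 'rV[R]_N := \row_(i < N) X i x.
pose h (p : 'rV[R]_N) x := \sum_i `|corotating_field K (row_X x) p ord0 i|.
rewrite (_ : mkset _ = [set x | exists2 p, O p & h p x = 0]); last first.
  apply/seteqP; split=> x /=.
    move=> /supports_equilibrium[p Op pE]; exists p => //.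
    by rewrite /h pE big1// => i _; rewrite mxE normr0.
  move=> [p Op /eqP]; rewrite psumr_eq0 => [/allP hp|//].
  apply/supports_equilibrium; exists p => //; apply/rowP => i.
  apply/eqP; rewrite [X in _ == X]mxE -normr_eq0.
  by have := hp i; rewrite mem_index_enum; apply.
apply: measurable_exists_zero.
(* Finitely many strict inequalities between continuous functions define an open set, which the
   description by a list of roots does not show. *)
- have -> : O = [set p | forall k : 'I_N, 0 < (char_poly (kuramoto_jacobian K p))`_k.+1].
    have stableP p := orbitally_stable_coef N_gt0
      (kuramoto_jacobian_sym K p) (kuramoto_jacobian_ones K p).
    by apply/seteqP; split=> p /stableP.
  rewrite openE => p Op.
  apply: (@filter_forall _ _ (fun (k : 'I_N) p =>
    is_true (0 < (char_poly (kuramoto_jacobian K p))`_k.+1)) (nbhs p)) => k.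
  apply: cvgr_gt (Op k); move: p {Op}; apply: coef_continuous_char_poly => i j.
  exact: continuous_kuramoto_jacobian.
- move=> x; apply: continuous_sumr => i p.
  have dK := is_diff_comp (is_diff_kuramoto_field K
    (row_X x - const_mx (mean (row_X x))) p) (is_diff_coord _ ord0 i).
  exact: cvg_norm (differentiable_continuous (@ex_diff _ _ _ _ _ _ _ dK)).
- move=> p; apply: measurable_sum => i; apply: measurableT_comp => //.
  have -> : (fun x => corotating_field K (row_X x) p ord0 i) =
      (fun x => X i x - (\sum_(j < N) X j x) / N%:R +
        K / N%:R * \sum_j sin (p ord0 j - p ord0 i)).
    apply/funext => x; rewrite !mxE /mean; congr (_ - _ / _ + _).
    by apply: eq_bigr => j _; rewrite mxE.
  apply: measurable_funD => //; apply: measurable_funB => //.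
  by apply: measurable_funM => //; exact: measurable_sum.
- by move=> p x; exact: sumr_ge0.
Qed.

Lemma measurable_spread X N : measurable_fun setT (spread X N).
Proof.
rewrite /spread; apply: measurable_funB.
- elim: (index_enum _) => [|i r IHr]; first by under eq_fun do rewrite big_nil;
    exact: measurable_funPT.
  by under eq_fun do rewrite big_cons; exact: measurable_maxr.
- elim: (index_enum _) => [|i r IHr]; first by under eq_fun do rewrite big_nil;
    exact: measurable_funPT.
  by under eq_fun do rewrite big_cons; exact: measurable_minr.
Qed.

Lemma le_spread X N x (i j : 'I_N) : X i x - X j x <= spread X N x.
Proof. by apply: lerB; [exact: le_bigmax|exact: bigmin_le]. Qed.

Lemma spread_le X N x (c : R) : (0 < N)%N ->
  (forall i j : 'I_N, X i x - X j x <= c) -> spread X N x <= c.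
Proof.
move=> N_gt0 Xc; rewrite lerBlDr.
(* The default [X 0 x] of both big operators is the entry of index 0, available since [0 < N]; three
   of the four cases involve it. *)
apply: bigmax_le => [|i _]; rewrite -lerBlDl; apply: le_bigmin => [|j _];
  rewrite lerBlDl -lerBlDr ?Xc//.
- by have := Xc (Ordinal N_gt0) (Ordinal N_gt0); rewrite !subrr.
- exact: (Xc (Ordinal N_gt0)).
- exact: (Xc _ (Ordinal N_gt0)).
Qed.

End measurability.

(** * Probability of synchronization *)

(** Here [c] is the supremum of [u] over an eventual set: finite because it is below [a] and the set
    is nonempty. The gap between [c] and [a] leaves room for the tolerance [e]. *)
Lemma limn_esup_lt (R : realType) (u : nat -> R) (a : R) :
  (limn_esup (fun n => (u n)%:E) < a%:E)%E ->
  exists2 c, c < a & \forall n \near \oo, u n <= c.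
Proof.
move=> /ereal_inf_lt[_ [V Voo <-]] supV.
have le_sup n : V n -> ((u n)%:E <= ereal_sup ((fun n => (u n)%:E) @` V))%E.
  by move=> Vn; apply: ereal_sup_ubound; exists n.
have [n0 Vn0] : exists n, V n by exact: (filter_ex Voo).
have := le_sup _ Vn0; move: supV le_sup.
case: (ereal_sup _) => [c| |]//; rewrite lte_fin => ca le_c _.
by exists c => //; apply: filterS Voo => n /le_c; rewrite lee_fin.
Qed.

Section synchronization.
Context {d : measure_display} {T : measurableType d} {R : realType}.
Variables (P : probability T R) (X : nat -> {RV P >-> R}) (xi : nat -> R).

Definition atypical_spread (e : R) N : set T :=
  [set x | `|spread X N x / xi N - 1| > e].

Lemma measurable_atypical_spread e N : measurable (atypical_spread e N).
Proof.
have mf : measurable_fun setT (fun x => `|spread X N x / xi N - 1|).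
  apply: measurableT_comp => //; apply: measurable_funB => //.
  by apply: measurable_funM => //; exact: measurable_spread.
rewrite (_ : atypical_spread e N =
    (fun x => `|spread X N x / xi N - 1|) @^-1` `]e, +oo[%classic).
  by rewrite -[X in measurable X]setTI; apply: mf => //; exact: measurable_itv.
by apply/seteqP; split=> x /=; rewrite in_itv/= andbT.
Qed.

(** Synchronization gives [spread <= 2 K < (1 - e) xi N], an atypically small spread. *)
Lemma P_sync_le N e K : (0 < N)%N -> 0 < xi N -> 0 <= K -> K / xi N < (1 - e) / 2 ->
  (P_sync X N K <= P (atypical_spread e N))%E.
Proof.
move=> N_gt0 xi_gt0 K0 Kxi; apply: le_measure; rewrite ?inE.
- exact: measurable_supports.
- exact: measurable_atypical_spread.
move=> x /supports_equilibrium[p _ p_eq]; rewrite /atypical_spread/= distrC.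
have M_le : spread X N x <= 2 * K.
  apply: spread_le => // i j.
  by have := equilibrium_spread i j K0 p_eq; rewrite !mxE.
apply: lt_le_trans (ler_norm _).
have : spread X N x / xi N <= 2 * (K / xi N).
  by rewrite mulrA ler_wpM2r// invr_ge0 ltW.
by lra.
Qed.

(** Off the atypical event [spread <= (1 + e) xi N < K], which forces synchronization. *)
Lemma P_sync_ge N e K : (0 < N)%N -> 0 < xi N -> 1 + e < K / xi N ->
  (1 - P (atypical_spread e N) <= P_sync X N K)%E.
Proof.
move=> N_gt0 xi_gt0 Kxi; have mA := measurable_atypical_spread e N.
rewrite -probability_setC//; apply: le_measure; rewrite ?inE.
- exact: measurableC.
- exact: measurable_supports.
move=> x /negP; rewrite -leNgt => Mx /=.
apply: supports_of_spread_lt => // i j; rewrite !mxE.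
apply: le_lt_trans (le_spread X x i j) _.
rewrite -(ltr_pM2r (x := (xi N)^-1)) ?invr_gt0//; apply: le_lt_trans Kxi.
by move: Mx => /(le_trans (ler_norm _)); rewrite lerBlDl.
Qed.

End synchronization.

Theorem theorem5p4 (R : realType) (d : measure_display) (T : measurableType d)
    (P : probability T R) (omega : nat -> {RV P >-> R}) (F : R -> R)
    (xi gamma : nat -> R)
    (omega_iid : iid_with_cdf omega F)
    (omega_nondet : forall i, non_deterministic (omega i))
    (xi_gt0 : forall N, (0 < N)%N -> 0 < xi N)
    (omega_MMC : MMC omega xi)
    (gamma_gt0 : forall N, (0 < N)%N -> 0 < gamma N) :
  ((limn_esup (fun N => (gamma N / xi N)%:E) < (1 / 2 : R)%:E)%E ->
     P_sync omega N (gamma N) @[N --> \oo] --> 0%E) /\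
  ((1%:E < limn_einf (fun N => (gamma N / xi N)%:E))%E ->
     P_sync omega N (gamma N) @[N --> \oo] --> 1%E).
Proof.
split=> [/limn_esup_lt[c c_lt bound]|].
  (* This makes [(1 - e) / 2] the midpoint of [c] and 1/2. *)
  pose e := (1 - 2 * c) / 2; have e_gt0 : 0 < e by rewrite /e; lra.
  have := omega_MMC _ e_gt0.
  apply: (@squeeze_cvge _ _ _ _ (cst 0%E)); last exact: cvg_cst.
  near=> N; have N_gt0 : (0 < N)%N by near: N; exact: nbhs_infty_gt.
  rewrite measure_ge0/=; apply: P_sync_le; rewrite ?xi_gt0 ?ltW ?gamma_gt0//.
  have : gamma N / xi N <= c by near: N; exact: bound.
  by rewrite /e; lra.
(* The lower limit is minus the upper limit of the negated ratios, so [- c > 1] is eventually a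
   lower bound of the ratios. *)
rewrite /limn_einf lteNr => /(@limn_esup_lt _ (fun N => - (gamma N / xi N)))
  [c c_lt bound].
(* This makes [1 + e] the midpoint of 1 and [- c]. *)
pose e := (- c - 1) / 2; have e_gt0 : 0 < e by rewrite /e; lra.
have Pbad := omega_MMC _ e_gt0.
have lower : (1 - P (atypical_spread omega xi e N))%E @[N --> \oo] --> 1%E.
  rewrite -[X in _ --> X]sube0; apply: cvgeB => //; exact: cvg_cst.
apply: (squeeze_cvge _ lower (cvg_cst 1%E)).
near=> N; have N_gt0 : (0 < N)%N by near: N; exact: nbhs_infty_gt.
rewrite probability_le1 ?andbT; last exact: measurable_supports.
apply: P_sync_ge; rewrite ?xi_gt0//.
have : - (gamma N / xi N) <= c by near: N; exact: bound.
by rewrite /e; lra.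
Unshelve. all: by end_near. Qed.
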